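(* Let $K$ be a finite $k$-dimensional simplicial complex, where $k\ge1$, with at least two $k$-faces, and let $L^{\mathrm{up}}_{k-1}(K)$ be its unnormalized $(k-1)$-dimensional up-Laplacian. Then $$\lambda_2\bigl(L^{\mathrm{up}}_{k-1}(K)\bigr)\ \ge\ d_2(K)+k-1 .$$
   Context: A simplicial complex $K$ on a finite vertex set is a collection of subsets closed under taking subsets; a face with $m+1$ vertices has dimension $m$, and $K_j$ is the set of $j$-dimensional faces; $K$ is $k$-dimensional if $k$ is the largest dimension of a face (purity is not assumed). The $(k-1)$-faces are called ridges; the upper degree of a ridge $\rho$ is $d(\rho)=|\{F\in K_k:\rho\subset F\}|$, and $d_1(K)\ge d_2(K)\ge\cdots$ are the upper degrees of all the ridges, with multiplicity, in nonincreasing order. Choose an orientation (an ordering of the vertices, up to even permutations) of each face. The boundary matrix $B_k=([\sigma:F])_{\sigma\in K_{k-1},F\in K_k}$ has $[\sigma:F]=0$ if $\sigma\not\subset F$, and if $F=[v_0,\dots,v_k]$ and $\sigma=F\setminus\{v_i\}$ then $[\sigma:F]=(-1)^i\operatorname{sgn}(\pi)$, where $\pi$ is the permutation carrying $(v_0,\dots,\widehat{v_i},\dots,v_k)$ to the chosen ordering of $\sigma$. The up-Laplacian is $L^{\mathrm{up}}_{k-1}(K)=B_kB_k^{\mathsf T}$. For a real symmetric matrix $A$, $\lambda_1(A)\ge\lambda_2(A)\ge\cdots$ are its eigenvalues counted with multiplicity. *)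

(* Defs.v *)
From mathcomp Require Import all_boot all_order all_fingroup all_algebra.
From mathcomp Require Import polyrcf.
From mathcomp Require Import reals.

Set Implicit Arguments.
Unset Strict Implicit.
Unset Printing Implicit Defensive.
Import Order.TTheory GRing.Theory Num.Theory.
Local Open Scope ring_scope.

Section Complex.
Variable T : finType.
Implicit Types (K : {set {set T}}) (o : {set T} -> seq T) (F G : {set T}).

Definition simplicial_complex K : Prop :=
  forall F G, F \in K -> G \subset F -> G \in K.

(* Dimension is cardinality minus one; the empty face, of dimension -1, is in
   no [faces K j]. *)
Definition faces K (j : nat) : {set {set T}} := [set F in K | #|F| == j.+1].

Definition has_dim K (k : nat) : Prop :=
  (exists F, F \in faces K k) /\ (forall F, F \in K -> (#|F| <= k.+1)%N).

Definition updeg K k (rho : {set T}) : nat :=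
  #|[set F in faces K k | rho \subset F]|.

(* The list d_1 >= d_2 >= ..., indexed from 0. *)
Definition updegs K k : seq nat :=
  sort geq [seq updeg K k rho | rho <- enum (faces K k.-1)].

(* An orientation is given by a representative ordering of each face; no
   quotient by even permutations is taken. *)
Definition orientation K o : Prop :=
  forall F, F \in K -> uniq (o F) /\ o F =i F.

End Complex.

Section Boundary.
Variables (R : pzRingType) (T : finType).
Implicit Types (K : {set {set T}}) (o : {set T} -> seq T) (F : {set T}).

(* Sign of the permutation carrying the duplicate-free sequence s to its
   rearrangement t.  It is required to fix every point outside s, which makes
   it unique; the value 0 is for sequences that are not rearrangements. *)
Definition carry_sgn (s t : seq T) : R :=
  if [pick p : {perm T} | perm_on [set x in s] p && (map p s == t)] is Some p
  then (-1) ^+ (odd_perm p) else 0.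

(* [sigma : F]: the vertex v with sigma = F \ {v} is unique if it exists, and
   [index v (o F)] is its position in the ordering [v_0, ..., v_k] of F. *)
Definition incidence o (sigma F : {set T}) : R :=
  if [pick v in F | sigma == F :\ v] is Some v then
    (-1) ^+ (index v (o F)) * carry_sgn (rem v (o F)) (o sigma)
  else 0.

Definition boundary_mx K o k : 'M[R]_(#|faces K k.-1|, #|faces K k|) :=
  \matrix_(i < #|faces K k.-1|, j < #|faces K k|)
    incidence o (enum_val i) (enum_val j).

Definition up_laplacian K o k : 'M[R]_(#|faces K k.-1|) :=
  boundary_mx K o k *m (boundary_mx K o k)^T.

End Boundary.

(* The real eigenvalues in nonincreasing order, repeated according to
   multiplicity in the characteristic polynomial; for a symmetric matrix these
   are all n eigenvalues.  [eigenvals A]`_i is lambda_(i+1). *)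
Definition eigenvals (R : rcfType) (n : nat) (A : 'M[R]_n) : seq R :=
  sort >=%R (flatten
    [seq nseq (mup a (char_poly A)) a | a <- rootsR (char_poly A)]).

(* Main.v *)
Require Import Defs.
From mathcomp Require Import all_boot all_order all_fingroup all_algebra.
From mathcomp Require Import polyrcf complex.
From mathcomp Require Import reals.
From mathcomp Require Import ring lra zify.

(* Let L = B B^T be the up-Laplacian, let rho and tau be two ridges with
   d(rho) >= d(tau) >= 1, and put mu = d(tau) + k - 1.  If the form of
   L (L - mu) is nonnegative and the form of L positive definite on
   span(e_rho, e_tau), then lambda_2(L) >= mu: otherwise some vector of the
   complexified plane is orthogonal to the top eigenvector, and in an
   eigenbasis every term of the form of L (L - mu) on it is nonpositive,
   hence zero, so that the form of L vanishes on it.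
   The entries of the 2 x 2 form of L^2 come from the vector B^T L e_rho on the
   k-faces: it equals (d(rho) + k) B^T e_rho on the faces containing rho, and it
   is bounded by 1 on every other face G, because at most two ridges of G
   contribute and two contributions cancel by "boundary of boundary is zero".
   The plane is degenerate only if d(rho) = d(tau) = 1 and rho, tau lie in a
   common k-face; when d_2(K) <= 1, choosing rho and tau in distinct k-faces
   avoids this. *)

Set Implicit Arguments.
Unset Strict Implicit.
Unset Printing Implicit Defensive.
Import Order.TTheory GRing.Theory Num.Theory.
Local Open Scope ring_scope.

(** * Eigenvalues of real symmetric matrices *)

(** The root list is duplicate-free, so each value contributes its multiplicity [mup] exactly once,
    and that is its number of occurrences in [s]. *)
Lemma perm_eigenvals (R : rcfType) n (A : 'M[R]_n) (s : seq R) :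
  char_poly A = \prod_(x <- s) ('X - x%:P) -> perm_eq (eigenvals A) s.
Proof.
move=> charA; rewrite /eigenvals perm_sort.
have pN0 : char_poly A != 0 by rewrite monic_neq0 ?char_poly_monic.
have rootsP x : (x \in rootsR (char_poly A)) = (x \in s).
  have /(_ x) := roots_on_rootsR pN0; rewrite in_itv /= => <-.
  by rewrite charA root_prod_XsubC.
apply/allP => x _ /=; apply/eqP.
rewrite count_flatten -map_comp sumnE big_map.
rewrite (eq_bigr (fun a => (a == x) * count_mem x s)%N); last first.
  move=> a _ /=; rewrite count_nseq charA mu_prod_XsubC /=.
  by case: eqP => [->|]; rewrite ?mul0n.
rewrite -big_distrl /=; have [xs|xs] := boolP (x \in s); last first.
  by move/count_memPn: xs => ->; rewrite muln0.
rewrite -[X in _ = X]mul1n; congr (_ * _)%N.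
rewrite -rootsP in xs.
by rewrite -big_mkcond /= sum1_count (count_uniq_mem _ (uniq_roots _ _ _)) xs.
Qed.

(** In a nonincreasing sequence everything from the second entry on is below [mu]. Sequences with
    fewer than two entries, where [nth] returns its default, meet the bound by their length. *)
Lemma count_ge_nth1 (R : realDomainType) (s : seq R) (mu : R) :
  sorted >=%R s -> nth 0 s 1 < mu -> (count (fun x => (mu <= x)%R) s <= 1)%N.
Proof.
case: s => [|x [|y s]] //=; first by case: (_ <= _).
move=> /andP[_ ys] ymu.
rewrite (_ : count _ s = 0%N) ?[mu <= y]leNgt ?ymu ?addn0 ?leq_b1 //.
apply/eqP; rewrite -leqn0 leqNgt -has_count; apply/hasPn => z zs.
have /allP/(_ _ zs) /= zy := order_path_min (rev_trans le_trans) ys.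
by rewrite -ltNge (le_lt_trans zy).
Qed.

Lemma char_poly_conj (F : fieldType) n (P A : 'M[F]_n) : P \in unitmx ->
  char_poly (invmx P *m A *m P) = char_poly A.
Proof.
move=> Pu; pose pC := map_mx (@polyC F) : 'M_n -> 'M_n.
have E : pC (invmx P) *m pC P = 1%:M by rewrite -map_mxM mulVmx // map_mx1.
rewrite /char_poly.
have -> : char_poly_mx (invmx P *m A *m P) = pC (invmx P) *m char_poly_mx A *m pC P.
  rewrite /char_poly_mx mulmxBr mulmxBl !map_mxM -/pC; congr (_ - _).
  by rewrite -mulmxA mul_scalar_mx -scalemxAr E scalemx1.
by rewrite !det_mulmx mulrAC -det_mulmx E det1 mul1r.
Qed.

(** * Spectral decomposition and a lower bound for the second eigenvalue *)

Section Spectral.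
Local Open Scope sesquilinear_scope.
Variable R : rcfType.
Local Notation toC := (real_complex R).
Local Notation C := R[i].

(** The spectral theorem is applied to the complexification of [A], which is hermitian and so has
    real eigenvalues; the characteristic polynomial descends because the embedding of polynomials is
    injective. *)
Lemma real_symmetric_spectral n (A : 'M[R]_n) : A^T = A ->
  exists (P : 'M[C]_n) (r : 'rV[R]_n),
    [/\ P \is unitarymx,
        map_mx toC A = P ^t* *m diag_mx (map_mx toC r) *m P &
        char_poly A = \prod_i ('X - (r 0 i)%:P)].
Proof.
move=> Asym; pose AC : 'M[C]_n := map_mx toC A.
have Aherm : AC \is hermsymmx.
  apply: realsym_hermsym.
    by apply/is_hermitianmxP; rewrite expr0 scale1r map_mx_id // map_trmx Asym.
  by apply/mxOverP => i j; rewrite !mxE complex_real.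
pose P := spectralmx AC; pose d := spectral_diag AC.
have Pu : P \is unitarymx := spectral_unitarymx _.
have dreal := hermitian_spectral_diag_real Aherm.
pose r : 'rV[R]_n := \row_j complex.Re (d 0 j).
have dE : d = map_mx toC r.
  apply/rowP => j; rewrite !mxE RRe_real //.
  by move/mxOverP: dreal; apply.
have /hermitian_normalmx/orthomx_spectralP AE := Aherm.
exists P, r; split=> //; first by rewrite -invmx_unitary // -dE.
apply: (map_poly_inj toC).
rewrite -/(map_poly _ _) map_char_poly -/AC AE char_poly_conj ?spectral_unit //.
rewrite char_poly_trig ?diag_mx_is_trig // rmorph_prod; apply: eq_bigr => i _.
by rewrite rmorphB /= map_polyX map_polyC !mxE eqxx mulr1n -/d dE mxE.
Qed.

Lemma diag_form n (r : 'rV[C]_n) (z : 'rV[C]_n) :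
  (z *m diag_mx r *m z^t*) 0 0 = \sum_i r 0 i * `|z 0 i| ^+ 2.
Proof.
rewrite mul_mx_diag !mxE; apply: eq_bigr => i _.
by rewrite !mxE normCK mulrAC mulrA [r 0 i * _]mulrC mulrAC.
Qed.

(** The cross terms of [x] and [y] cancel because [M] is symmetric; real hypotheses on the form thus
    apply to complex vectors. *)
Lemma real_form_complexify n (M : 'M[R]_n) (x y : 'rV[R]_n) : M^T = M ->
  let w := map_mx toC x + 'i *: map_mx toC y in
  (w *m map_mx toC M *m w^t*) 0 0 =
    toC ((x *m M *m x^T) 0 0 + (y *m M *m y^T) 0 0).
Proof.
move=> Msym w.
have -> : w^t* = map_mx toC x^T - 'i *: map_mx toC y^T.
  apply/matrixP => j k; rewrite !mxE rmorphD rmorphM /= conjCi mulNr.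
  by rewrite !conj_Creal // complex_real.
have xy : y *m M *m x^T = x *m M *m y^T.
  apply/matrixP => i j; rewrite !ord1.
  transitivity ((x *m M *m y^T)^T 0 0); last by rewrite mxE.
  by rewrite !trmx_mul Msym trmxK mulmxA.
rewrite /w !mulmxDl !mulmxBr -!scalemxAl -!scalemxAr -!map_mxM xy.
rewrite scalerA -expr2 sqrCi scaleN1r opprK addrA subrK rmorphD.
by rewrite !mxE.
Qed.

Lemma second_eigenval_ge n m (B : 'M[R]_(n, m)) (U : 'M[R]_(2, n)) (mu : R) :
  let A := B *m B^T in
  (forall c : 'rV_2, c != 0 -> 0 < (c *m (U *m A *m U^T) *m c^T) 0 0) ->
  (forall c : 'rV_2, mu * (c *m (U *m A *m U^T) *m c^T) 0 0 <=
     (c *m (U *m (A *m A) *m U^T) *m c^T) 0 0) ->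
  mu <= nth 0 (eigenvals A) 1.
Proof.
move=> A posA geA; rewrite leNgt; apply/negP => evlt.
have Asym : A^T = A by rewrite /A trmx_mul trmxK.
have [P [r [Pu AE charA]]] := real_symmetric_spectral Asym.
have PP : P *m P^t* = 1%:M by apply/unitarymxP.
have PP' : P^t* *m P = 1%:M by rewrite mulmx1C.
(* [A] is a Gram matrix, so its diagonal entries in the eigenbasis are sums of squared moduli. *)
have r_ge0 i : 0 <= r 0 i.
  rewrite -lecR.
  have <- : (P *m map_mx toC A *m P^t*) i i = toC (r 0 i).
    rewrite AE !mulmxA PP mul1mx -mulmxA PP mulmx1.
    by rewrite !mxE eqxx mulr1n.
  pose Q := P *m map_mx toC B.
  have -> : P *m map_mx toC A *m P^t* = Q *m Q^t*.
    rewrite /A map_mxM /Q trmx_mul map_mxM !mulmxA; congr (_ *m _ *m _).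
    by apply/matrixP => k l; rewrite !mxE /= conj_Creal // complex_real.
  rewrite mxE sumr_ge0 // => j _; rewrite !mxE -normCK exprn_ge0 //.
have count1 : (count (fun i => (mu <= r 0 i)%R) (enum 'I_n) <= 1)%N.
  have := count_ge_nth1 (sort_sorted (fun x y => le_total y x) _) evlt.
  have {}charA : char_poly A = \prod_(x <- [seq r 0 i | i <- enum 'I_n]) ('X - x%:P).
    by rewrite charA big_map big_enum.
  have /seq.permP -> := perm_eigenvals charA.
  by rewrite count_map.
pose UC := map_mx toC U *m P^t*.
(* At most one index [i] has [mu <= r 0 i], so this is one linear equation in two unknowns; swapping
   its coefficients and negating one solves it, unless both vanish. *)
have [c cN0 cU] : exists2 c : 'rV[C]_2, c != 0 &
    forall i, mu <= r 0 i -> (c *m UC) 0 i = 0.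
  case: (pickP (fun i => mu <= r 0 i)) => [i mui|none]; last first.
    exists (delta_mx 0 0); last by move=> i; rewrite none.
    by apply/eqP => /matrixP/(_ 0 0)/eqP; rewrite !mxE oner_eq0.
  have topP j : mu <= r 0 j -> j = i.
    move=> muj; apply/eqP; apply: contraLR count1 => ji.
    rewrite -ltnNge -(size_filter _ (enum _)) -[2%N]/(size [:: i; j]).
    apply: uniq_leq_size => [|l].
      by rewrite /= inE eq_sym ji.
    by rewrite !inE mem_filter mem_enum andbT => /orP[] /eqP ->.
  have [/andP[/eqP U0 /eqP U1]|UN0] := boolP ((UC 0 i == 0) && (UC 1 i == 0)).
    exists (delta_mx 0 0).
      by apply/eqP => /matrixP/(_ 0 0)/eqP; rewrite !mxE oner_eq0.
    by move=> j /topP ->; rewrite -rowE mxE.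
  exists (\row_j (if j == 0 then UC 1 i else - UC 0 i)).
    apply: contra UN0 => /eqP/rowP cc.
    move: (cc 0) (cc 1); rewrite !mxE /= => -> /eqP; rewrite oppr_eq0 => ->.
    by rewrite eqxx.
  move=> j /topP ->; rewrite mxE big_ord_recl big_ord1 !mxE /=.
  rewrite (_ : lift ord0 ord0 = 1) //; last exact/val_inj.
  by rewrite mulNr mulrC subrr.
pose cx : 'rV[R]_2 := map_mx (@complex.Re R) c.
pose cy : 'rV[R]_2 := map_mx (@complex.Im R) c.
have cE : c = map_mx toC cx + 'i *: map_mx toC cy.
  by apply/rowP => j; rewrite !mxE [LHS]complexE complexiE.
pose w := map_mx toC (cx *m U) + 'i *: map_mx toC (cy *m U).
pose z := c *m UC.
have wz : w = z *m P.
  rewrite /z /UC mulmxA -mulmxA PP' mulmx1 {1}cE mulmxDl -scalemxAl.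
  by rewrite -!map_mxM.
have zP : z = w *m P^t* by rewrite wz -mulmxA PP mulmx1.
(* In the eigenbasis coordinates [z] the form is a weighted sum of squared moduli; this serves for
   both [A] and [A *m A]. *)
have form M (d : 'rV[R]_n) : M^T = M ->
    map_mx toC M = P^t* *m diag_mx (map_mx toC d) *m P ->
    toC ((cx *m (U *m M *m U^T) *m cx^T) 0 0 +
         (cy *m (U *m M *m U^T) *m cy^T) 0 0) =
    \sum_i toC (d 0 i) * `|z 0 i| ^+ 2.
  move=> Msym ME; transitivity (\sum_i map_mx toC d 0 i * `|z 0 i| ^+ 2).
    rewrite -diag_form.
    have E (x : 'rV_2) : x *m (U *m M *m U^T) *m x^T = (x *m U) *m M *m (x *m U)^T.
      by rewrite trmx_mul !mulmxA.
    rewrite !E -real_form_complexify // -/w wz ME trmx_mul map_mxM !mulmxA.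
    by rewrite -(mulmxA z P) PP mulmx1 -(mulmxA _ P) PP mulmx1.
  by apply: eq_bigr => i _; rewrite mxE.
pose r2 : 'rV[R]_n := \row_i (r 0 i) ^+ 2.
have A2E : map_mx toC (A *m A) = P^t* *m diag_mx (map_mx toC r2) *m P.
  rewrite map_mxM AE !mulmxA -(mulmxA _ P) PP mulmx1; congr (_ *m _).
  rewrite -mulmxA mulmx_diag; congr (_ *m diag_mx _).
  by apply/rowP => i; rewrite !mxE expr2 rmorphM.
have A2sym : (A *m A)^T = A *m A by rewrite trmx_mul Asym.
have f1 := form A r Asym AE; have f2 := form _ _ A2sym A2E.
set g := (_ + _ : R) in f1; set h := (_ + _ : R) in f2.
have gh : mu * g <= h by rewrite mulrDr lerD.
have g_gt0 : 0 < g.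
  have ge0 (x : 'rV_2) : 0 <= (x *m (U *m A *m U^T) *m x^T) 0 0.
    have [->|/posA/ltW//] := eqVneq x 0.
    by rewrite mul0mx mul0mx mxE.
  have [cx0|/posA cxp] := eqVneq cx 0; last by rewrite ltr_pwDl.
  have [cy0|/posA cyp] := eqVneq cy 0; last by rewrite ltr_pwDr.
  by move: cN0; rewrite cE cx0 cy0 !map_mx0 scaler0 addr0 eqxx.
(* The terms of [mu * g - h]: [z] vanishes where [mu <= r 0 i], and elsewhere all factors are
   nonnegative. Their sum is at most 0 by [gh], so each of them is 0. *)
pose t i := toC (r 0 i * (mu - r 0 i)) * `|z 0 i| ^+ 2.
have t_ge0 i : 0 <= t i.
  rewrite /t; have [/cU|/ltW rmu] := leP mu (r 0 i).
    by rewrite -/z => ->; rewrite normr0 expr0n mulr0.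
  by rewrite mulr_ge0 ?exprn_ge0 // ler0c mulr_ge0 ?subr_ge0.
have tsum : \sum_i t i = 0.
  apply/le_anti; rewrite sumr_ge0 // andbT.
  have -> : \sum_i t i = toC (mu * g - h).
    rewrite rmorphB rmorphM /= f1 f2 mulr_sumr -sumrB; apply: eq_bigr => i _.
    by rewrite mulrA -mulrBl -rmorphM -rmorphB /= mxE /t mulrBr [mu * _]mulrC expr2.
  by rewrite lecR subr_le0.
have t0 i : t i = 0.
  by have /psumr_eq0P/(_ i) := tsum; apply.
(* Where [r 0 i < mu], the factor [mu - r 0 i] cancels from [t i = 0]; hence every term of [g]
   vanishes too, against [g_gt0]. *)
suff : toC g = 0 by move/eqP; rewrite (inj_eq (@complexI R)) gt_eqF.
rewrite f1 big1 // => i _; have [/cU|rmu] := leP mu (r 0 i).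
  by rewrite -/z => ->; rewrite normr0 expr0n mulr0.
have := t0 i; rewrite /t rmorphM mulrAC => /eqP; rewrite mulf_eq0.
by rewrite (inj_eq (@complexI R)) subr_eq0 (gt_eqF rmu) orbF => /eqP.
Qed.
End Spectral.

(** * Incidence signs *)

Section Signs.
Variables (R : comPzRingType) (T : finType).
Implicit Types (s t r : seq T) (u v x : T) (p q : {perm T}).
Local Notation carry_sgn := (@carry_sgn R T).

Lemma carry_sgn_map s p : perm_on [set x in s] p ->
  carry_sgn s (map p s) = (-1) ^+ p.
Proof.
move=> ps; rewrite /Defs.carry_sgn; case: pickP => [q /andP[qs /eqP/eq_in_map pq]|].
  suff -> : q = p by [].
  apply/permP => x; have [/pq//|xs] := boolP (x \in s).
  by rewrite (out_perm qs) ?(out_perm ps) ?inE.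
by move/(_ p); rewrite ps eqxx.
Qed.

Lemma carry_perm_ex s t : uniq s -> perm_eq s t ->
  exists2 p, perm_on [set x in s] p & map p s = t.
Proof.
move=> us st; have ut : uniq t by rewrite -(perm_uniq st).
have szE := perm_size st; have memE := perm_mem st.
(* Sends each entry of [s] to the entry of [t] at the same position and fixes all other points. *)
pose f x := if x \in s then nth x t (index x s) else x.
have fs x : x \in s -> f x \in s.
  by move=> xs; rewrite /f xs memE mem_nth // -szE index_mem.
have finj : injective f.
  move=> x y; have := fs x; have := fs y; rewrite /f.
  case: ifP => ys; case: ifP => xs //.
  - move=> _ _; rewrite (set_nth_default x) -?szE ?index_mem // => /eqP.
    rewrite nth_uniq -?szE ?index_mem // => /eqP/(congr1 (nth x s)).
    by rewrite !nth_index.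
  - by move=> /(_ isT) h _ e; rewrite -e xs in h.
  - by move=> _ /(_ isT) h e; rewrite e ys in h.
exists (perm finj).
  by apply/subsetP => x; rewrite !inE permE /f; case: ifP; rewrite ?eqxx.
case Es: (s) => [|x0 s']; first by move: (perm_size st); rewrite Es; case: (t).
rewrite -Es; apply: (@eq_from_nth _ x0) => [|i]; rewrite size_map // => lti.
rewrite (nth_map x0) // permE /f mem_nth // index_uniq //.
by rewrite (set_nth_default x0) // -szE.
Qed.

Lemma carry_sgn_trans t s r : uniq s -> perm_eq s t -> perm_eq t r ->
  carry_sgn s r = carry_sgn s t * carry_sgn t r.
Proof.
move=> us st tr; have ut : uniq t by rewrite -(perm_uniq st).
have [p ps pE] := carry_perm_ex us st; have [q qt qE] := carry_perm_ex ut tr.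
have qs : perm_on [set x in s] q.
  by congr (perm_on _ _): qt; apply/setP => x; rewrite !inE (perm_mem st).
have -> : carry_sgn s t = (-1) ^+ p by rewrite -pE carry_sgn_map.
have -> : carry_sgn t r = (-1) ^+ q by rewrite -qE carry_sgn_map.
have -> : r = map (p * q)%g s.
  by rewrite -qE -pE -map_comp; apply: eq_map => x; rewrite permM.
by rewrite carry_sgn_map ?perm_onM // odd_permM signr_addb.
Qed.

Lemma carry_sgn_refl s : carry_sgn s s = 1.
Proof.
rewrite -{2}[s]map_id -(eq_map (fun x => perm1 x)) carry_sgn_map ?perm_on1 //.
by rewrite odd_perm1.
Qed.

Lemma carry_sgn_sqr s t : uniq s -> perm_eq s t -> carry_sgn s t ^+ 2 = 1.
Proof.
move=> us st; have [p ps <-] := carry_perm_ex us st.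
by rewrite carry_sgn_map // sqrr_sign.
Qed.

Lemma carry_sgnC s t : uniq s -> perm_eq s t -> carry_sgn s t = carry_sgn t s.
Proof.
move=> us st; have ut : uniq t by rewrite -(perm_uniq st).
rewrite -[LHS]mulr1 -(carry_sgn_sqr (t := s) ut) 1?perm_sym //.
by rewrite expr2 mulrA -carry_sgn_trans ?carry_sgn_refl ?mul1r // perm_sym.
Qed.

Lemma carry_sgn_cons x s t : uniq (x :: s) -> perm_eq s t ->
  carry_sgn (x :: s) (x :: t) = carry_sgn s t.
Proof.
move=> /= /andP[xs us] st; have [p ps <-] := carry_perm_ex us st.
rewrite carry_sgn_map //.
have -> : x :: map p s = map p (x :: s) by rewrite /= (out_perm ps) ?inE.
rewrite carry_sgn_map //.
by apply: subset_trans ps _; apply/subsetP => y; rewrite !inE => ->; rewrite orbT.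
Qed.

Lemma carry_sgn_swap s1 x u s2 : uniq (s1 ++ x :: u :: s2) ->
  carry_sgn (s1 ++ x :: u :: s2) (s1 ++ u :: x :: s2) = -1.
Proof.
set s := s1 ++ _ => us.
have : uniq s by []; rewrite /s cat_uniq /= !inE !negb_or -!andbA.
move=> /and5P[_ xs1 us1 _ /and4P[xu xs2 us2 _]].
have fixed y : y != x -> y != u -> tperm x u y = y.
  by move=> yx yu; rewrite tpermD // eq_sym.
have -> : s1 ++ u :: x :: s2 = map (tperm x u) s.
  rewrite /s map_cat /= tpermL tpermR.
  congr (_ ++ _ :: _ :: _); apply/esym/map_id_in => y ys; apply: fixed.
  - by apply: contraNneq xs1 => <-.
  - by apply: contraNneq us1 => <-.
  - by apply: contraNneq xs2 => <-.
  - by apply: contraNneq us2 => <-.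
rewrite carry_sgn_map ?odd_tperm ?xu //.
apply/subsetP => y; rewrite !inE mem_cat !inE; apply: contraR.
by rewrite !negb_or => /and4P[_ yx yu _]; rewrite fixed.
Qed.

(** Induction on the prefix from its right end: [u] passes one entry at a time, each time by a
    transposition. *)
Lemma carry_sgn_front s1 u s2 : uniq (s1 ++ u :: s2) ->
  carry_sgn (s1 ++ u :: s2) (u :: s1 ++ s2) = (-1) ^+ size s1.
Proof.
elim/last_ind: s1 s2 => [|s1 x IH] s2; first by rewrite carry_sgn_refl.
rewrite -cats1 -!catA /= => us.
have swap : perm_eq (s1 ++ x :: u :: s2) (s1 ++ u :: x :: s2).
  by rewrite perm_cat2l (perm_catCA [:: x] [:: u] s2).
rewrite (carry_sgn_trans us swap) ?(perm_catCA s1 [:: u]) //.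
rewrite carry_sgn_swap // IH -?(perm_uniq swap) //.
by rewrite size_cat addn1 exprS.
Qed.

(** Move [u] to the front of [s], rearrange the tail, then move [u] back to its place in [t]: the
    two moves cost the index signs. *)
Lemma carry_sgn_rem u s t : uniq s -> perm_eq s t -> u \in s ->
  carry_sgn s t =
    (-1) ^+ index u s * (-1) ^+ index u t * carry_sgn (rem u s) (rem u t).
Proof.
move=> us st uins; have ut : uniq t by rewrite -(perm_uniq st).
have front w : uniq w -> u \in w ->
    [/\ perm_eq w (u :: rem u w) & carry_sgn w (u :: rem u w) = (-1) ^+ index u w].
  move=> uw uinw; split; first exact: perm_to_rem.
  case/splitPr: uinw uw => w1 w2 uw.
  have uw1 : u \notin w1 by move: uw; rewrite cat_uniq /= => /and3P[_ /norP[]].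
  rewrite remE index_cat (negPf uw1) /= eqxx addn0.
  by rewrite take_size_cat // drop_cat ltnNge leqW // subSnn /= drop0 carry_sgn_front.
have uint : u \in t by rewrite -(perm_mem st).
have [s1 s2] := front _ us uins; have [t1 t2] := front _ ut uint.
have st1 : perm_eq (rem u s) (rem u t).
  by rewrite -(perm_cons u) -(permPl s1) (permPl st).
rewrite (carry_sgn_trans us s1) ?s2; last by rewrite -(permPl s1).
rewrite (@carry_sgn_trans (u :: rem u t)) ?perm_cons //; last 2 first.
- by rewrite -(perm_uniq s1).
- by rewrite perm_sym.
rewrite carry_sgn_cons // -?(perm_uniq s1) //.
by rewrite -(carry_sgnC ut t1) t2 -mulrA; congr (_ * _); rewrite mulrC.
Qed.

End Signs.

(** * Incidence numbers and the vanishing of the double boundary *)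

Section Incidence.
Variables (R : comPzRingType) (T : finType).
Variables (K : {set {set T}}) (o : {set T} -> seq T).
Hypotheses (Kcomplex : simplicial_complex K) (Korient : orientation K o).
Implicit Types (F G : {set T}) (u v : T).
Local Notation inc := (incidence R o).

Lemma incidence_del F v : v \in F ->
  inc (F :\ v) F = (-1) ^+ index v (o F) * carry_sgn R (rem v (o F)) (o (F :\ v)).
Proof.
move=> vF; rewrite /incidence; case: pickP => [w /andP[wF /eqP E]|/(_ v)].
  suff -> : w = v by [].
  by apply/eqP; move/setP/(_ w): E; rewrite !inE eqxx wF /= andbT => /negbFE.
by rewrite vF eqxx.
Qed.

Lemma incidence_eq0 F G : (forall v, v \in F -> G != F :\ v) -> inc G F = 0.
Proof.
move=> GF; rewrite /incidence; case: pickP => // w /andP[wF] E.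
by case/negP: (GF w wF).
Qed.

Lemma del_face F v : F \in K -> F :\ v \in K.
Proof. by move=> FK; apply: Kcomplex FK (subsetDl _ _). Qed.

Lemma orient_uniq F : F \in K -> uniq (o F). Proof. by case/Korient. Qed.

Lemma mem_orient F : F \in K -> o F =i F. Proof. by case/Korient. Qed.

Lemma orient_del F v : F \in K -> perm_eq (rem v (o F)) (o (F :\ v)).
Proof.
move=> FK; have FvK := del_face v FK.
apply: uniq_perm; rewrite ?rem_uniq ?orient_uniq // => x.
by rewrite mem_rem_uniq ?orient_uniq // mem_orient // !inE mem_orient.
Qed.

Lemma incidence_sqr F v : F \in K -> v \in F -> inc (F :\ v) F ^+ 2 = 1.
Proof.
move=> FK vF; rewrite incidence_del // exprMn sqrr_sign mul1r.
by rewrite carry_sgn_sqr ?orient_del ?rem_uniq ?orient_uniq.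
Qed.

Lemma remC (A : eqType) (a b : A) s : rem a (rem b s) = rem b (rem a s).
Proof.
elim: s => //= x s IH.
have [xb|xb] := eqVneq x b; have [xa|xa] := eqVneq x a => /=.
- by rewrite -xb -xa.
- by rewrite xb eqxx.
- by rewrite xa eqxx.
- by rewrite (negPf xb) (negPf xa) IH.
Qed.

(* Both sides equal a sign times [carry_sgn] of [o F] with [u], [v] removed;
   removing the first of the two shifts the index of the other by one. *)
Lemma boundary_boundary F u v : F \in K -> u \in F -> v \in F -> u != v ->
  inc (F :\ u :\ v) (F :\ u) * inc (F :\ u) F =
  - (inc (F :\ v :\ u) (F :\ v) * inc (F :\ v) F).
Proof.
pose idx (a b : T) s : R := (-1) ^+ index a s * (-1) ^+ index b (rem a s).
have step (a b : T) : F \in K -> a \in F -> b \in F -> a != b ->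
    inc (F :\ a :\ b) (F :\ a) * inc (F :\ a) F =
    idx a b (o F) * carry_sgn R (rem b (rem a (o F))) (o (F :\ a :\ b)).
  move=> FK aF bF ab; rewrite !incidence_del ?inE 1?eq_sym ?ab //.
  have FaK := del_face a FK; have oF := orient_del a FK.
  have uF : uniq (rem a (o F)) by rewrite rem_uniq ?orient_uniq.
  have bo : b \in rem a (o F) by rewrite (perm_mem oF) mem_orient // !inE eq_sym ab.
  have sgn2 n : (-1) ^+ n * (-1) ^+ n = 1 :> R by rewrite -expr2 sqrr_sign.
  rewrite (carry_sgn_rem R uF oF bo).
  have rem2 : perm_eq (rem b (rem a (o F))) (rem b (o (F :\ a))).
    rewrite -(perm_cons b) -(permPl (perm_to_rem bo)) (permPl oF).
    by rewrite perm_to_rem // -(perm_mem oF).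
  rewrite [in RHS](carry_sgn_trans R _ rem2) ?rem_uniq // ?orient_del //.
  rewrite /idx; set x := (-1) ^+ index b (o _); set y := carry_sgn _ _ (o _).
  set z := carry_sgn _ _ _; set w := (-1) ^+ _; set t := (-1) ^+ _.
  have xx : x * x = 1 by apply: sgn2.
  (* The sign [x] of [b] in the ordering of [F :\ a] occurs once in an incidence number and once
     from [carry_sgn_rem]. *)
  transitivity (x * x * (w * t * (z * y))); last by rewrite xx mul1r.
  ring.
  exact: orient_uniq.
move=> FK uF vF uv; rewrite !step // 1?eq_sym //.
rewrite -mulNr remC; congr (_ * carry_sgn _ _ (o _)); last first.
  by rewrite !setDDl setUC.
have : uniq (o F) := orient_uniq FK.
have : u \in o F by rewrite mem_orient.
have : v \in o F by rewrite mem_orient.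
rewrite /idx; elim: (o F) => //= x s IH.
rewrite !inE ![_ == x]eq_sym; have [xu|xu] := eqVneq x u.
  rewrite -xu in uv *; rewrite (negPf uv) /= eqxx => vs _ _.
  by rewrite !expr0 mulr1 mul1r exprS mulN1r opprK.
have [xv|xv] := eqVneq x v.
  rewrite /= xv eqxx => _ us _.
  by rewrite !expr0 mulr1 mul1r exprS mulN1r.
rewrite /= (negPf xu) (negPf xv) => vs us /andP[_ ss].
by rewrite !exprS !mulN1r !mulrNN IH.
Qed.
End Incidence.

(** * Entries of the up-Laplacian and of its square *)

Section UpLaplacian.
Variables (R : rcfType) (T : finType).
Variables (K : {set {set T}}) (o : {set T} -> seq T) (k : nat).
Hypotheses (k_gt0 : (0 < k)%N).
Hypotheses (Kcomplex : simplicial_complex K) (Korient : orientation K o).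
Implicit Types (F G : {set T}) (rho tau : {set T}) (u v : T).
Local Notation inc := (incidence R o).
Local Notation ridges := (faces K k.-1).
Local Notation facets := (faces K k).
Local Notation deg := (updeg K k).

(** Entries of the up-Laplacian, indexed by ridges instead of ordinals; [up_laplacianE] makes the
    link. *)
Definition up_entry rho tau : R := \sum_(F in facets) inc rho F * inc tau F.

(* The entry of [B^T L e_rho] at the facet [G]. *)
Definition co_up rho G : R := \sum_(tau in ridges) inc tau G * up_entry tau rho.

Lemma ridgesP rho : rho \in ridges -> rho \in K /\ #|rho| = k.
Proof. by rewrite inE => /andP[-> /eqP ->]; rewrite prednK. Qed.

Lemma facetsP F : F \in facets -> F \in K /\ #|F| = k.+1.
Proof. by rewrite inE => /andP[-> /eqP ->]. Qed.

Lemma incidence_le1 F G : `|inc F G| <= 1.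
Proof.
rewrite /incidence; case: pickP => [v _|_]; last by rewrite normr0.
rewrite normrM normr_sign mul1r /carry_sgn.
by case: pickP => [p _|_]; rewrite ?normr_sign ?normr0.
Qed.

Lemma incidence_out rho F : ~~ (rho \subset F) -> inc rho F = 0.
Proof.
move=> rF; apply: incidence_eq0 => v vF; apply: contraNneq rF => ->.
exact: subsetDl.
Qed.

Lemma del_ridge F v : F \in facets -> v \in F -> F :\ v \in ridges.
Proof.
move=> /facetsP[FK cF] vF; rewrite inE del_face //=.
by move: (cardsD1 v F); rewrite vF cF add1n prednK // => -[<-].
Qed.

Lemma ridge_del rho F : rho \in ridges -> F \in facets -> rho \subset F ->
  exists2 v, v \in F & rho = F :\ v.
Proof.
move=> /ridgesP[_ cr] /facetsP[_ cF] rF.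
have /cards1P[v Dv] : #|F :\: rho| == 1.
  by rewrite cardsD (setIidPr rF) cr cF subSnn.
have vF : v \in F by have := set11 v; rewrite -Dv inE => /andP[].
exists v => //; rewrite -Dv setDDr setDv set0U; exact/esym/setIidPr.
Qed.

Lemma incidence_in_sqr rho F : rho \in ridges -> F \in facets -> rho \subset F ->
  inc rho F ^+ 2 = 1.
Proof.
move=> rK FK rF; have [v vF ->] := ridge_del rK FK rF.
by apply: (incidence_sqr R Kcomplex Korient) => //; case/facetsP: FK.
Qed.

(** Only the ridges [G :\ v] can have nonzero incidence in [G], and distinct [v] give distinct
    ridges. *)
Lemma sum_ridges G (f : {set T} -> R) : G \in facets ->
  \sum_(tau in ridges) inc tau G * f tau =
  \sum_(v in G) inc (G :\ v) G * f (G :\ v).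
Proof.
move=> GK; rewrite (bigID (fun tau => tau \in [set G :\ v | v in G])) /=.
rewrite [X in _ + X]big1 ?addr0 => [|tau /andP[tK tG]]; last first.
  rewrite incidence_eq0 ?mul0r // => v vG; apply: contraNneq tG => ->.
  exact: imset_f.
transitivity (\sum_(tau in [set G :\ v | v in G]) inc tau G * f tau); last first.
  rewrite big_imset // => v w vG wG /setP/(_ v).
  by rewrite !inE eqxx vG !andbT => /esym/negbFE/eqP.
apply: eq_bigl => tau; rewrite andbC; apply: andb_idr => /imsetP[v vG ->].
exact: del_ridge.
Qed.

Lemma up_entryC rho tau : up_entry rho tau = up_entry tau rho.
Proof. by apply: eq_bigr => F _; rewrite mulrC. Qed.

Lemma up_entry_diag rho : rho \in ridges -> up_entry rho rho = (deg rho)%:R.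
Proof.
move=> rK; rewrite /updeg -sum1_card natr_sum.
rewrite (eq_bigl (fun F => (F \in facets) && (rho \subset F))); last first.
  by move=> F; rewrite [LHS]inE.
rewrite big_mkcondr; apply: eq_bigr => F FK; rewrite -expr2.
by case: ifPn => [/incidence_in_sqr->//|/incidence_out->]; rewrite expr0n.
Qed.

(** Two distinct [k]-sets have a union of more than [k] elements, and here it lies in a set of [k+1]
    elements. *)
Lemma ridge_union rho tau F : rho \in ridges -> tau \in ridges -> rho != tau ->
  F \in facets -> rho \subset F -> tau \subset F -> F = rho :|: tau.
Proof.
move=> /ridgesP[_ cr] /ridgesP[_ ct] rt /facetsP[_ cF] rF tF.
apply/esym/eqP; rewrite eqEcard subUset rF tF cF /= -cr proper_card //.
rewrite properEneq subsetUl andbT; apply: contraNneq rt => rE.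
by rewrite eq_sym eqEcard cr ct leqnn andbT; apply/setUidPl/esym.
Qed.

Lemma up_entry_neq rho tau : rho \in ridges -> tau \in ridges -> rho != tau ->
  up_entry rho tau = if rho :|: tau \in facets
    then inc rho (rho :|: tau) * inc tau (rho :|: tau) else 0.
Proof.
move=> rK tK rt.
have out F : F \in facets -> F != rho :|: tau -> inc rho F * inc tau F = 0.
  move=> FK FE; have [rF|/incidence_out->] := boolP (rho \subset F);
    last by rewrite mul0r.
  have [tF|/incidence_out->] := boolP (tau \subset F); last by rewrite mulr0.
  by rewrite (ridge_union rK tK rt FK rF tF) eqxx in FE.
rewrite /up_entry; case: ifPn => HK; last first.
  by apply: big1 => F FK; apply: out => //; apply: contraNneq HK => <-.
by rewrite (bigD1 _ HK) /= big1 ?addr0 // => F /andP[]; apply: out.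
Qed.

(** Multiply [boundary_boundary] by suitable signs, all of square 1. It trades signs in [F] for
    signs of the common codimension-two face, which is the empty face when [k = 1]. *)
Lemma incidence_mul F u v : F \in K -> u \in F -> v \in F -> u != v ->
  inc (F :\ u) F * inc (F :\ v) F =
  - (inc (F :\ u :\ v) (F :\ u) * inc (F :\ u :\ v) (F :\ v)).
Proof.
move=> FK uF vF uv.
have := boundary_boundary R Kcomplex Korient FK uF vF uv.
have -> : F :\ v :\ u = F :\ u :\ v by rewrite !setDDl setUC.
set a := inc _ (F :\ u); set b := inc _ F; set c := inc _ (F :\ v); set d := inc _ F.
move=> E; have a2 : a ^+ 2 = 1.
  apply: (incidence_sqr R Kcomplex Korient); rewrite ?del_face // !inE vF eq_sym uv //.
have d2 : d ^+ 2 = 1 by apply: (incidence_sqr R Kcomplex Korient).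
transitivity (a ^+ 2 * b * d); first by rewrite a2 mul1r.
transitivity (- (a * c * d ^+ 2)); last by rewrite d2 mulr1.
rewrite expr2 -[a * a * b]mulrA E; ring.
Qed.

(** The ridge [rho] itself contributes its degree. For each of the other [k] ridges of [G], the only
    k-face shared with [rho] is [G], so its own sign appears squared and [inc rho G] remains. *)
Lemma co_up_in rho G : rho \in ridges -> G \in facets -> rho \subset G ->
  co_up rho G = ((deg rho)%:R + k%:R) * inc rho G.
Proof.
move=> rK GK rG; rewrite /co_up sum_ridges //.
have [w wG rE] := ridge_del rK GK rG; have [GinK cG] := facetsP GK.
rewrite (bigD1 w) //= -rE up_entry_diag // mulrDl mulrC; congr (_ + _).
rewrite (eq_bigr (fun=> inc rho G)) => [|v /andP[vG vw]].
  rewrite sumr_const mulr_natl; congr (_ *+ _).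
  have <- : #|G :\ w| = k by move: (cardsD1 w G); rewrite wG cG => -[].
  by apply: eq_card => v; rewrite !inE andbC.
have Gvr : G :\ v != rho.
  by apply/eqP => /setP/(_ v); rewrite rE !inE eqxx vG (negPf vw).
have GvK := del_ridge GK vG.
have UE : G :\ v :|: rho = G.
  by apply/esym/ridge_union => //; exact: subsetDl.
rewrite up_entry_neq // UE GK mulrA -expr2.
by rewrite incidence_in_sqr ?subsetDl // mul1r.
Qed.

(* At most two ridges of [G] contribute; each contribution can be rewritten
   through the face [G :&: rho] by [incidence_mul], and then the two cancel by
   [boundary_boundary] in [G]. *)
Lemma co_up_out rho G : rho \in ridges -> G \in facets -> ~~ (rho \subset G) ->
  `|co_up rho G| <= 1.
Proof.
move=> rK GK rG; rewrite /co_up sum_ridges //.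
have [GinK cG] := facetsP GK; have [rinK cr] := ridgesP rK.
have delN v : v \in G -> G :\ v != rho.
  by move=> _; apply: contraNneq rG => <-; exact: subsetDl.
have cap_lt : (#|G :&: rho| < k)%N.
  rewrite -cr proper_card // properEneq subsetIr andbT.
  by apply: contraNneq rG => <-; exact: subsetIl.
(* A union of size [k+1] means an intersection of size [k-1]; by [cap_lt] this is already the size
   of [G :&: rho], so deleting [v] loses nothing and [v] is outside [rho]. *)
have capD v : v \in G -> G :\ v :|: rho \in facets ->
    [/\ v \notin rho, #|G :\: rho| = 2 & #|G :&: rho| = k.-1].
  move=> vG /facetsP[_ cU]; have := cardsUI (G :\ v) rho.
  have := cardsD1 v G; rewrite vG cG cU cr => -[cGv].
  have capS : (#|(G :\ v) :&: rho| <= #|G :&: rho|)%N.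
    by apply/subset_leq_card/setSI/subsetDl.
  have := cardsID rho G; rewrite cG => cID cUI.
  have cE : #|G :&: rho| = k.-1 by lia.
  split; [|lia|by []].
  apply/negP => vr; have : (#|(G :\ v) :&: rho| < #|G :&: rho|)%N; last by lia.
  apply/proper_card/properP; split; first exact/setSI/subsetDl.
  by exists v; rewrite !inE ?vG ?eqxx.
pose f v := inc (G :\ v) G * up_entry (G :\ v) rho.
have f0 v : v \in G -> ~ (v \notin rho /\ #|G :\: rho| = 2) -> f v = 0.
  move=> vG D; rewrite /f up_entry_neq ?del_ridge ?delN //.
  by case: ifPn => [/(capD _ vG)[? ? _]|_]; [case: D | rewrite mulr0].
have [/eqP/cards2P[u [v [uv Duv]]]|D2] := eqVneq #|G :\: rho| 2; last first.
  rewrite big1 ?normr0 // => v vG; apply: f0 => // -[_ /eqP].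
  by rewrite (negPf D2).
have inD x : (x \in G) && (x \notin rho) = (x == u) || (x == v).
  by rewrite -in_set2 -Duv !inE andbC.
have /andP[uG ur] : (u \in G) && (u \notin rho) by rewrite inD eqxx.
have /andP[vG vr] : (v \in G) && (v \notin rho) by rewrite inD eqxx orbT.
rewrite (bigD1 u) //= (bigD1 v) /=; last by rewrite vG eq_sym.
rewrite big1 ?addr0 => [|x /andP[/andP[xG xu] xv]]; last first.
  apply: f0 => // -[xr _]; have := inD x.
  by rewrite xG xr (negPf xu) (negPf xv).
pose C := G :&: rho.
have CE : G :\ u :\ v = C.
  apply/setP => x; have := inD x; rewrite !inE.
  by case: (x \in G); case: (x \in rho); case: eqP; case: eqP.
have CE' : G :\ v :\ u = C by rewrite -CE !setDDl setUC.
(* With [F] the union and [a] the one vertex of [rho] outside [G], both [F :\ a = G :\ x] and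
   [F :\ y = rho] hold, so [incidence_mul] passes through [C]. *)
have term x y : x \in G -> y \in G -> x != y -> y \notin rho -> G :\ x :\ y = C ->
    f x = - (inc C rho * (inc C (G :\ x) * inc (G :\ x) G))
            *+ (G :\ x :|: rho \in facets).
  move=> xG yG xy yr xyC; rewrite /f up_entry_neq ?del_ridge ?delN //.
  case: ifPn => FK; last by rewrite mulr0.
  have [xr _ cC] := capD x xG FK.
  have /cards1P[a Da] : #|rho :\: G| == 1.
    by rewrite cardsD setIC cC cr -[X in (X - _)%N](prednK k_gt0) subSnn.
  have /andP[aG ar] : (a \notin G) && (a \in rho) by rewrite -in_setD Da set11.
  set F := _ :|: _ in FK *.
  have ay : a != y by apply: contraNneq aG => ->.
  have Fa : F :\ a = G :\ x.
    apply/setP => z; have /setP/(_ z) := Da; rewrite !inE.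
    have [->|za] /= := eqVneq z a; first by rewrite (negPf aG) andbF.
    case: (z \in G) => /= [_|->]; rewrite ?andbF // !andbT.
    by have [->|//] := eqVneq z x; rewrite (negPf xr).
  have Fy : F :\ y = rho.
    apply/setP => z; rewrite !inE; have [->|zy] /= := eqVneq z y;
      first by rewrite (negPf yr).
    have /setP/(_ z) := xyC; rewrite !inE zy /= => ->.
    by case: (z \in rho); rewrite ?orbT ?andbF.
  have aF : a \in F by rewrite inE ar orbT.
  have yF : y \in F by rewrite !inE eq_sym xy yG.
  have FinK : F \in K by case/facetsP: FK.
  have := incidence_mul FinK aF yF ay.
  rewrite Fa Fy xyC mulr1n => ->; ring.
rewrite -/(f u) -/(f v) (term u v) // (term v u) 1?eq_sym //.
have := boundary_boundary R Kcomplex Korient GinK uG vG uv.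
rewrite CE CE' => /esym/eqP; rewrite eqr_oppLR => /eqP ->.
have n1 : `|inc C rho * (inc C (G :\ u) * inc (G :\ u) G)| <= 1.
  by rewrite !normrM !mulr_ile1 ?mulr_ge0 ?incidence_le1.
(* The two possible contributions are now opposite: both present cancel, one alone has modulus at
   most 1. *)
case: (_ \in _); case: (_ \in _); rewrite ?mulr1n ?mulr0n ?addr0 ?add0r //.
- by rewrite mulrN opprK addNr normr0.
- by rewrite normrN.
- by rewrite mulrN opprK.
- by rewrite normr0.
Qed.

(* The [(tau, rho)] entry of [L *m L]. *)
Definition sq_entry rho tau : R := \sum_(G in facets) inc tau G * co_up rho G.

Lemma sq_entry_diag rho : rho \in ridges ->
  sq_entry rho rho = (deg rho)%:R * ((deg rho)%:R + k%:R).
Proof.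
move=> rK; rewrite -{1}up_entry_diag // mulr_suml; apply: eq_bigr => G GK.
have [rG|/incidence_out->] := boolP (rho \subset G); last by rewrite !mul0r.
by rewrite co_up_in // mulrCA mulrC.
Qed.

Lemma up_entry_le1 rho tau : rho \in ridges -> tau \in ridges -> rho != tau ->
  `|up_entry rho tau| <= 1.
Proof.
move=> rK tK rt; rewrite up_entry_neq //; case: ifP; rewrite ?normr0 //.
by rewrite normrM mulr_ile1 ?incidence_le1.
Qed.

(** Compare facet by facet over those containing [tau]. If [rho] is also contained, the difference
    vanishes by [co_up_in] and the facet is charged to [up_entry]; otherwise [co_up_out] bounds the
    difference by 1. *)
Lemma sq_entry_bound rho tau : rho \in ridges -> tau \in ridges -> rho != tau ->
  `|sq_entry rho tau - ((deg rho)%:R + k%:R) * up_entry rho tau|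
    <= (deg tau)%:R - `|up_entry rho tau|.
Proof.
move=> rK tK rt.
have -> : sq_entry rho tau - ((deg rho)%:R + k%:R) * up_entry rho tau =
    \sum_(G in facets) inc tau G * (co_up rho G - ((deg rho)%:R + k%:R) * inc rho G).
  rewrite mulr_sumr -sumrB; apply: eq_bigr => G _; rewrite mulrBr; congr (_ - _).
  by rewrite [RHS]mulrCA [inc tau G * _]mulrC.
rewrite lerBrDr; apply: le_trans (lerD (ler_norm_sum _ _ _) (ler_norm_sum _ _ _)) _.
rewrite -big_split -(up_entry_diag tK) /= /up_entry; apply: ler_sum => G GK.
have [tG|/incidence_out->] := boolP (tau \subset G); last first.
  by rewrite !(mulr0, mul0r) normr0 addr0.
rewrite -expr2 incidence_in_sqr // !normrM.
have t1 : `|inc tau G| = 1.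
  by apply/eqP; rewrite -sqrp_eq1 // -normrX incidence_in_sqr // normr1.
rewrite t1 mul1r mulr1; have [rG|rG] := boolP (rho \subset G).
  by rewrite co_up_in // subrr normr0 add0r incidence_le1.
by rewrite incidence_out // mulr0 subr0 normr0 addr0 co_up_out.
Qed.

(** * The quadratic forms on the plane of two ridges *)

Local Notation L := (up_laplacian R K o k).

Lemma up_laplacianE i j : L i j = up_entry (enum_val i) (enum_val j).
Proof.
rewrite !mxE /up_entry [RHS]big_enum_val /=.
by apply: eq_bigr => F _; rewrite !mxE.
Qed.

Lemma up_laplacian_sqE i j : (L *m L) i j = sq_entry (enum_val j) (enum_val i).
Proof.
rewrite /sq_entry [RHS]big_enum_val /= {1}/up_laplacian -mulmxA !mxE.
apply: eq_bigr => F _; rewrite mxE; congr (_ * _).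
rewrite mxE /co_up [RHS]big_enum_val /=.
by apply: eq_bigr => l _; rewrite !mxE -up_laplacianE mxE.
Qed.

(** Write d1, d2 for the degrees of [rho], [tau] and mu = d2 + k - 1. The form of L(L - mu) has
    diagonal entries d1(d1 - d2 + 1) and d2 and off-diagonal entry q = t - mu s, with s and t the
    entries of L and its square. It is nonnegative because q^2 <= d1^2 <= d1 d2 (d1 - d2 + 1). *)
Lemma second_eigenval_ridges rho tau : rho \in ridges -> tau \in ridges ->
  rho != tau -> (0 < deg tau <= deg rho)%N ->
  (1 < deg rho)%N \/ rho :|: tau \notin facets ->
  (deg tau)%:R + k%:R - 1 <= nth 0 (eigenvals L) 1.
Proof.
move=> rK tK rt /andP[d2_gt0 d21] d1s.
pose i := enum_rank_in rK rho; pose j := enum_rank_in rK tau.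
have iE : enum_val i = rho by rewrite enum_rankK_in.
have jE : enum_val j = tau by rewrite enum_rankK_in.
pose f (a : 'I_2) := if a == 0 then i else j.
pose U : 'M[R]_(2, _) := rowsub f 1%:M.
have UE (M : 'M[R]_(#|ridges|)) (c : 'rV_2) : (c *m (U *m M *m U^T) *m c^T) 0 0 =
    c 0 0 ^+ 2 * M i i + c 0 0 * c 0 1 * (M i j + M j i) + c 0 1 ^+ 2 * M j j.
  have -> : U *m M *m U^T = mxsub f f M.
    rewrite mul_rowsub_mx mul1mx -[_ *m U^T]trmxK trmx_mul trmxK mul_rowsub_mx mul1mx.
    by apply/matrixP => a b; rewrite !mxE.
  rewrite !mxE !big_ord_recl !big_ord0 !mxE !big_ord_recl !big_ord0 !mxE.
  rewrite (_ : lift ord0 ord0 = 1) /f /=; last exact/val_inj.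
  ring.
have := sq_entry_bound rK tK rt.
have s1 := up_entry_le1 rK tK rt.
have s0 : (1 < deg rho)%N \/ up_entry rho tau = 0.
  case: d1s => [|Nf]; [by left | right].
  by rewrite up_entry_neq // (negPf Nf).
have Lsym : L^T = L by rewrite trmx_mul trmxK.
have sC : sq_entry tau rho = sq_entry rho tau.
  have LLsym : (L *m L)^T = L *m L by rewrite trmx_mul Lsym.
  have /matrixP/(_ i j) := LLsym.
  by rewrite [LHS]mxE !up_laplacian_sqE iE jE.
have [c0E c1E] : up_entry rho rho = (deg rho)%:R /\ up_entry tau tau = (deg tau)%:R.
  by rewrite !up_entry_diag.
set s := up_entry rho tau in s1 s0 *; set t := sq_entry rho tau in sC *.
set d1 := (deg rho)%:R : R; set d2 := (deg tau)%:R : R; set k' := k%:R : R.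
have d2_ge1 : 1 <= d2 by rewrite ler1n.
have d12 : d2 <= d1 by rewrite ler_nat.
have {}s0 : 2 <= d1 \/ s = 0 by case: s0 => [h|]; [left; rewrite ler_nat | right].
move=> tb.
(* By [tb] the two summands below are at most d2 - |s| and (d1 - d2 + 1)|s|; they add up to d2 + (d1
   - d2)|s|, at most d1 since |s| <= 1. *)
have qb : `|t - (d2 + k' - 1) * s| <= d1.
  have -> : t - (d2 + k' - 1) * s = (t - (d1 + k') * s) + (d1 - d2 + 1) * s by ring.
  apply: le_trans (ler_normD _ _) _; rewrite normrM.
  rewrite (ger0_norm (_ : 0 <= d1 - d2 + 1)); last by lra.
  nra.
apply: (second_eigenval_ge (U := U)) => c;
  rewrite -/L !UE ?up_laplacian_sqE !up_laplacianE iE jE;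
  rewrite [up_entry tau rho]up_entryC -/s c0E c1E.
  move=> cN0.
  (* Either d1 d2 >= 2 > s^2, or s = 0. *)
  have det_gt0 : 0 < d1 * d2 - s ^+ 2.
    have : s ^+ 2 <= 1 by rewrite -real_normK ?num_real ?expr_le1.
    by case: s0 => [|->]; nra.
  have xy : (c 0 0 != 0) || (c 0 1 != 0).
    apply: contraNT cN0 => /norP[/negPn/eqP x0 /negPn/eqP y0].
    apply/eqP/rowP => a; rewrite mxE; case: (unliftP 0 a) => [b|] -> //.
    by rewrite ord1 -[RHS]y0; congr (c 0 _); exact/val_inj.
  move: (c 0 0) (c 0 1) xy => x y xy.
  (* Multiplying by [d2] allows completing the square in [y] without division. *)
  rewrite -(pmulr_rgt0 _ (lt_le_trans ltr01 d2_ge1)).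
  have -> : d2 * (x ^+ 2 * d1 + x * y * (s + s) + y ^+ 2 * d2) =
      (y * d2 + x * s) ^+ 2 + x ^+ 2 * (d1 * d2 - s ^+ 2) by ring.
  have [x0|xN0] := eqVneq x 0; last first.
    by rewrite ltr_wpDl ?sqr_ge0 // mulr_gt0 // exprn_even_gt0.
  move: xy; rewrite x0 eqxx /= => yN0.
  rewrite expr0n mul0r !addr0 mul0r addr0 exprn_even_gt0 //= mulf_neq0 //.
  by rewrite gt_eqF // (lt_le_trans ltr01).
rewrite sC -/t !sq_entry_diag // -/d1 -/d2 -/k'.
move: (c 0 0) (c 0 1) => x y; set q := t - _ in qb.
have q2 : q ^+ 2 <= d1 ^+ 2.
  by rewrite -[q ^+ 2]real_normK ?num_real ?lerXn2r ?nnegrE //.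
have d1e : d1 ^+ 2 <= d1 * d2 * (d1 - d2 + 1).
  (* The difference of the two sides is (d2 - 1)(d1 - d2). *)
  have : d1 <= d2 * (d1 - d2 + 1) by nra.
  nra.
rewrite -subr_ge0 -(pmulr_rge0 _ (lt_le_trans ltr01 d2_ge1)).
set e := (X in 0 <= X).
have -> : e = (y * d2 + x * q) ^+ 2 + x ^+ 2 * (d1 * d2 * (d1 - d2 + 1) - q ^+ 2).
  rewrite /e /q; ring.
by rewrite addr_ge0 ?sqr_ge0 // mulr_ge0 ?sqr_ge0 // subr_ge0 (le_trans q2).
Qed.

End UpLaplacian.

(** * Choice of the two ridges *)

Lemma nth1_sort_geq (X : finType) (A : {set X}) (f : X -> nat) :
  (0 < nth 0 (sort geq [seq f x | x <- enum A]) 1)%N ->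
  exists x y, [/\ x \in A, y \in A, x != y, (f y <= f x)%N &
    nth 0%N (sort geq [seq f x | x <- enum A]) 1 = f y].
Proof.
(* Sorting the elements by [f], not the values, yields distinct elements; positivity excludes the
   default 0 of [nth], so there are two of them. *)
rewrite sort_map; set s := sort _ _.
have s_mem x : x \in s -> x \in A by rewrite mem_sort mem_enum.
have us : uniq s by rewrite sort_uniq enum_uniq.
have ss : sorted (relpre f geq) s by apply: sort_sorted => x y; apply: leq_total.
case: s s_mem us ss => [|x [|y s]] //= s_mem us /andP[yx _] _.
exists x, y; split=> //; try by apply: s_mem; rewrite !inE eqxx ?orbT.
by case/andP: us; rewrite inE => /norP[].
Qed.

Theorem theorem5p1 (R : realType) (T : finType) (K : {set {set T}})
    (o : {set T} -> seq T) (k : nat) :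
  (1 <= k)%N ->
  simplicial_complex K ->
  has_dim K k ->
  (2 <= #|faces K k|)%N ->
  orientation K o ->
  (nth 0%N (updegs K k) 1)%:R + k%:R - 1
    <= nth 0 (eigenvals (up_laplacian R K o k)) 1.
Proof.
move=> k_gt0 Kc _ facets2 Ko; set d2 := nth _ _ _.
(* The bound grows with the smaller degree, so any admissible pair whose smaller degree is at least
   [d2] will do. *)
have pair rho tau : rho \in faces K k.-1 -> tau \in faces K k.-1 -> rho != tau ->
    (0 < updeg K k tau <= updeg K k rho)%N -> (d2 <= updeg K k tau)%N ->
    (1 < updeg K k rho)%N \/ rho :|: tau \notin faces K k ->
    d2%:R + k%:R - 1 <= nth 0 (eigenvals (up_laplacian R K o k)) 1.
  move=> rK tK rt d21 d2t h.
  apply: le_trans (second_eigenval_ridges R k_gt0 Kc Ko rK tK rt d21 h).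
  by rewrite lerB // lerD2r ler_nat.
(* For [d2 > 1] the two ridges of largest degree work. Otherwise any ridge of a k-face has degree at
   least [d2], and two ridges from distinct k-faces are taken. *)
have [d2_le1|d2_gt1] := leqP d2 1; last first.
  have /nth1_sort_geq[x [y [xK yK xy yx d2E]]] : (0 < d2)%N by apply: ltnW.
  rewrite -/(updegs K k) -/d2 in d2E.
  apply: (pair x y) => //; rewrite -?d2E ?(ltnW d2_gt1) //=.
  - by rewrite d2E.
  - by left; apply: leq_trans yx; rewrite -d2E.
have [F [G [FK GK FG]]] := card_gt1P facets2.
have deg_gt0 (rho H : {set T}) : rho \subset H -> H \in faces K k ->
    (0 < updeg K k rho)%N.
  by move=> rH HK; apply/card_gt0P; exists H; rewrite inE HK.
have only1 (rho H H' : {set T}) : (updeg K k rho <= 1)%N ->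
    H \in faces K k -> H' \in faces K k ->
    rho \subset H -> rho \subset H' -> H = H'.
  move=> /card_le1_eqP d1 HK H'K rH rH'; apply: d1; by rewrite inE ?HK ?H'K.
have [u uF] : exists u, u \in F.
  by apply/card_gt0P; have [_ ->] := facetsP FK.
(* As [k >= 1], [G] has two vertices; deleting one or the other gives distinct ridges, so one of
   them differs from [F :\ u]. *)
have [v vG vN] : exists2 v, v \in G & G :\ v != F :\ u.
  have [_ cG] := facetsP GK.
  have /card_gt1P[v [w [vG wG vw]]] : (1 < #|G|)%N by rewrite cG.
  have [E|] := eqVneq (G :\ v) (F :\ u); last by exists v.
  exists w => //; rewrite -E; apply/eqP => /setP/(_ w).
  by rewrite !inE eqxx eq_sym vw wG.
have FuK := del_ridge k_gt0 Kc FK uF; have GvK := del_ridge k_gt0 Kc GK vG.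
have dF := deg_gt0 _ _ (subsetDl F [set u]) FK.
have dG := deg_gt0 _ _ (subsetDl G [set v]) GK.
(* If both degrees are at most 1, a k-face containing both ridges would have to equal both [F] and
   [G]. *)
have share : (1 < maxn (updeg K k (F :\ u)) (updeg K k (G :\ v)))%N \/
    F :\ u :|: G :\ v \notin faces K k.
  have [|] := ltnP; [by left | rewrite geq_max => /andP[dF1 dG1]].
  right; apply/negP => HK; case/eqP: FG.
  apply: etrans (only1 _ _ _ dF1 FK HK (subsetDl _ _) (subsetUl _ _)) _.
  exact/esym/(only1 _ _ _ dG1 GK HK (subsetDl _ _) (subsetUr _ _)).
have [le|/ltnW le] := leqP (updeg K k (G :\ v)) (updeg K k (F :\ u)).
  apply: (pair _ _ FuK GvK); rewrite ?dG ?le //; first by rewrite eq_sym.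
  - exact: leq_trans d2_le1 dG.
  - by rewrite (maxn_idPl le) in share.
apply: (pair _ _ GvK FuK) => //; rewrite ?dF ?le //.
- exact: leq_trans d2_le1 dF.
- by rewrite (maxn_idPr le) in share; rewrite setUC.
Qed.
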